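(* There exists a universal constant $c>0$ such that for every $p>1$ and every non-constant $p$-knowable Boolean function $f$, writing $\nu=\mathbb E[\max W(f)]$, $$\sup_kI_k(f)\ge c\,\mathrm{Var}(f)\frac{\log\nu}{\nu}-\frac1{p-1}\,\frac{\mathbb E[(\max W(f))^p]}{\nu^p}.$$
   Context: Let $\Omega=\{-1,1\}$ and $\Omega^\infty=\{-1,1\}^{\mathbb N}$ with the uniform product probability measure; $\omega$ denotes a uniformly random element. A Boolean function is a measurable map $f:\Omega^\infty\to\Omega$. $\omega^{(k)}$ is $\omega$ with bit $k$ flipped; $I_k(f)=\mathbb P(f(\omega^{(k)})\ne f(\omega))$. A set $W\subseteq\mathbb N$ is a witness set for $f$ at $\omega$ if there is an event $A$ with $\mathbb P(A)=1$ such that for all $\tilde\omega\in A$: if $\tilde\omega_i=\omega_i$ for all $i\in W$ then $f(\tilde\omega)=f(\omega)$. $f$ is finitary if almost surely a finite witness set exists; then $W(f)(\omega)$ denotes the least finite witness set in the order: smaller maximum first, then smaller cardinality, then lexicographic. $f$ is $p$-knowable if it is finitary and $\mathbb E[(\max W(f))^p]<\infty$. $\log$ is the natural logarithm. *)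

(* Defs.v *)
From HB Require Import structures.
From mathcomp Require Import all_boot all_order all_algebra.
From mathcomp Require Import all_classical all_reals all_analysis Rstruct.
Set Implicit Arguments.
Unset Strict Implicit.
Unset Printing Implicit Defensive.
Import Order.TTheory GRing.Theory Num.Theory.
Local Open Scope classical_set_scope.
Local Open Scope ring_scope.

Notation RR := Rdefinitions.R.

(* Omega^infty = {-1,1}^N.  A point is a sequence of bits  w : nat -> bool,
   where  true  stands for +1 and  false  for -1.  The Rocq index  i : nat
   (starting at 0) represents the paper's coordinate  i+1  (paper: N = {1,2,...}). *)
Definition coord_sets : set (set (nat -> bool)) :=
  [set A | exists (n : nat) (b : bool), A = [set w | w n = b]].

Definition Omega := g_sigma_algebraType coord_sets.

(* P is the uniform product probability: every cylinder fixing the first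
   n coordinates has probability 2^-n (this determines P uniquely on the
   product sigma-algebra). *)
Definition uniform_product (P : probability Omega RR) : Prop :=
  forall s : seq bool,
    P [set w : Omega | forall i, (i < size s)%N -> w i = nth false s i]
    = ((2 : RR) ^- size s)%:E.

Definition boolean_function (f : Omega -> bool) : Prop :=
  measurable_fun [set: Omega] f.

Definition valR (f : Omega -> bool) (w : Omega) : RR := if f w then 1 else -1.

Definition flip (k : nat) (w : Omega) : Omega :=
  fun i => if i == k then ~~ w i else w i.

Definition influence (P : probability Omega RR) (f : Omega -> bool) (k : nat) : RR :=
  fine (P [set w : Omega | f (flip k w) != f w]).

Definition Var (P : probability Omega RR) (f : Omega -> bool) : RR :=
  let m := fine (\int[P]_w (valR f w)%:E) in
  fine (\int[P]_w (((valR f w - m) ^+ 2)%:E)).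

Definition witness (P : probability Omega RR) (f : Omega -> bool)
    (w : Omega) (W : set nat) : Prop :=
  exists A : set Omega, measurable A /\ P A = 1%E /\
    forall w' : Omega, A w' -> (forall i, W i -> w' i = w i) -> f w' = f w.

Definition finitary (P : probability Omega RR) (f : Omega -> bool) : Prop :=
  {ae P, forall w : Omega, exists s : seq nat, witness P f w [set i | i \in s]}.

(* Finite subsets of N are represented canonically by strictly increasing
   lists of (Rocq) indices. *)
Definition fin_nat_set (s : seq nat) : Prop := sorted ltn s.

(* max W in the paper's numbering (coordinates 1,2,...); max of the empty set
   is taken to be 0. *)
Definition maxW (s : seq nat) : nat := \max_(i <- s) i.+1.

Fixpoint lex_lt (s t : seq nat) : bool :=
  match s, t with
  | [::], [::] => false
  | [::], _ :: _ => true
  | _ :: _, [::] => false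
  | x :: s', y :: t' => (x < y)%N || ((x == y) && lex_lt s' t')
  end.

Definition wit_lt (s t : seq nat) : bool :=
  (maxW s < maxW t)%N ||
  ((maxW s == maxW t) &&
   ((size s < size t)%N || ((size s == size t) && lex_lt s t))).

Definition least_witness (P : probability Omega RR) (f : Omega -> bool)
    (w : Omega) (s : seq nat) : Prop :=
  fin_nat_set s /\ witness P f w [set i | i \in s] /\
  forall t, fin_nat_set t -> witness P f w [set i | i \in t] ->
    t = s \/ wit_lt s t.

(* W(f)(w) (defined arbitrarily, as the empty set, where no finite witness set
   exists, which for finitary f is a null event). *)
Definition Wf (P : probability Omega RR) (f : Omega -> bool) (w : Omega) : seq nat :=
  xget [::] (least_witness P f w).

Definition maxWf (P : probability Omega RR) (f : Omega -> bool) (w : Omega) : RR :=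
  (maxW (Wf P f w))%:R.

Definition knowable (P : probability Omega RR) (p : RR) (f : Omega -> bool) : Prop :=
  finitary P f /\ (\int[P]_w ((maxWf P f w `^ p)%:E) < +oo)%E.

Definition nonconstant (P : probability Omega RR) (f : Omega -> bool) : Prop :=
  ~ exists b : bool, {ae P, forall w : Omega, f w = b}.

(* Main.v *)
Require Import Defs.
From HB Require Import structures.
From mathcomp Require Import all_boot all_order all_algebra.
From mathcomp Require Import all_classical all_reals all_analysis Rstruct.
From mathcomp Require Import measurable_realfun ring lra.
Set Implicit Arguments.
Unset Strict Implicit.
Unset Printing Implicit Defensive.
Import Order.TTheory GRing.Theory Num.Theory.
Local Open Scope classical_set_scope.
Local Open Scope ring_scope.

(** Let delta be the largest influence and S the total influence. Following
    Falik and Samorodnitsky, the logarithmic Sobolev inequality on the discrete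
    cube, applied to the martingale differences of a function of n bits, gives a
    KKL inequality [Var f * ln (1 / delta) <= C * S]. It holds for real-valued
    functions, hence for the conditional expectations of f given the first n
    bits. These are approximations of f with no larger influences, whose
    variance tends to [Var f] because f is almost surely determined by finitely
    many bits.
    In the other direction, bit k (counted from 1) matters only when
    [max W(f) >= k], so that [I_k <= min (delta, P (max W(f) >= k))] and
    [S <= nu * delta + E (max W(f) - nu)^+]. Since [(p - 1) (y - 1) <= y ^ p] for
    [y >= 1], the last term is at most [nu / (p - 1) * E (max W(f)) ^ p / nu ^ p].
    Comparing the two bounds on S proves the theorem if [delta <= nu ^ (-1/2)];
    otherwise it follows from [ln nu / nu <= 2 * nu ^ (-1/2)]. *)

(** * Entropy and influences on the discrete cube *)

Fixpoint flip_bit (k : nat) (s : seq bool) {struct s} : seq bool :=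
  if s is b :: s' then if k is k'.+1 then b :: flip_bit k' s' else ~~ b :: s'
  else [::].

Section cube.
Variable R : realType.
Implicit Types (h g u : seq bool -> R) (n k : nat).

(** Mean over [n] uniform bits. The recursion on the first bit lets inductions on the dimension
    split lists at the head. *)
Fixpoint avg n h : R :=
  if n is n'.+1 then
    (avg n' (fun s => h (false :: s)) + avg n' (fun s => h (true :: s))) / 2
  else h [::].

Lemma ler_avg n h g : (forall s, size s = n -> h s <= g s) -> avg n h <= avg n g.
Proof.
elim: n h g => [|n IH] h g hg /=; first exact: hg.
have := IH (fun s => h (false :: s)) (fun s => g (false :: s)).
have := IH (fun s => h (true :: s)) (fun s => g (true :: s)).
move=> /(_ (fun s sn => hg (true :: s) (congr1 S sn))) h1.
move=> /(_ (fun s sn => hg (false :: s) (congr1 S sn))) h2.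
lra.
Qed.

Lemma eq_avg n h g : (forall s, size s = n -> h s = g s) -> avg n h = avg n g.
Proof. by move=> hg; apply/le_anti/andP; split; apply: ler_avg => s /hg ->. Qed.

Lemma avgD n h g : avg n (fun s => h s + g s) = avg n h + avg n g.
Proof. by elim: n h g => [|n IH] h g //=; rewrite !IH; field. Qed.

Lemma avgZ n c h : avg n (fun s => c * h s) = c * avg n h.
Proof. by elim: n h => [|n IH] h //=; rewrite !IH; field. Qed.

Lemma avgB n h g : avg n (fun s => h s - g s) = avg n h - avg n g.
Proof. by elim: n h g => [|n IH] h g //=; rewrite !IH; field. Qed.

Lemma avg_cst n c : avg n (fun=> c) = c.
Proof. by elim: n => [|n IH] //=; rewrite !IH; field. Qed.

Lemma avg_ge0 n h : (forall s, size s = n -> 0 <= h s) -> 0 <= avg n h.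
Proof. by move=> h0; rewrite -[leLHS](avg_cst n); apply: ler_avg. Qed.

(** The mean of [(h - c * g) ^ 2] is nonnegative for every [c]; the minimising [c] gives the
    bound. *)
Lemma avg_cauchy_schwarz n h g :
  avg n (fun s => h s * g s) ^+ 2
  <= avg n (fun s => h s ^+ 2) * avg n (fun s => g s ^+ 2).
Proof.
have H c : 0 <= avg n (fun s => h s ^+ 2) - (2 * c) * avg n (fun s => h s * g s)
    + c ^+ 2 * avg n (fun s => g s ^+ 2).
  rewrite -!avgZ -avgB -avgD; apply: avg_ge0 => s _.
  suff -> : h s ^+ 2 - 2 * c * (h s * g s) + c ^+ 2 * g s ^+ 2
    = (h s - c * g s) ^+ 2 by rewrite sqr_ge0.
  by ring.
have B0 : 0 <= avg n (fun s => g s ^+ 2) by apply: avg_ge0 => s _; rewrite sqr_ge0.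
move: H B0; set A := avg n _; set X := avg n _; set B := avg n _ => H B0.
move: B0; rewrite le_eqVlt => /predU1P[B0|B0].
  have [->|X0] := eqVneq X 0; first by rewrite -B0; lra.
  (* With [B = 0] the quadratic is affine in [c], and this [c] would give it the value -1. *)
  have := H ((A + 1) / (2 * X)).
  rewrite -B0 mulr0 addr0.
  have -> : 2 * ((A + 1) / (2 * X)) * X = A + 1 by field.
  lra.
have := H (X / B).
have -> : A - 2 * (X / B) * X + (X / B) ^+ 2 * B = A - X ^+ 2 / B.
  by field; rewrite gt_eqF.
by rewrite subr_ge0 ler_pdivrMr.
Qed.

(** Unnormalised Dirichlet form: each edge of the cube is counted from both of its endpoints. *)
Definition energy n h :=
  \sum_(k < n) avg n (fun s => (h s - h (flip_bit k s)) ^+ 2).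

Definition abs_infl n k h := avg n (fun s => `|h s - h (flip_bit k s)|).

Definition cube_var n h := avg n (fun s => h s ^+ 2) - avg n h ^+ 2.

Lemma energyS n h : energy n.+1 h =
  avg n (fun s => (h (true :: s) - h (false :: s)) ^+ 2) +
  (energy n (fun s => h (false :: s)) + energy n (fun s => h (true :: s))) / 2.
Proof.
rewrite /energy big_ord_recl /= -big_split /= mulr_suml; congr (_ + _).
under eq_avg do rewrite -[_ - _]opprB sqrrN.
by field.
Qed.

(** * Logarithmic Sobolev inequality *)

Lemma xlnx_le (x y : R) : 0 <= x -> 0 < y -> x * ln x <= x * ln y + x * (x / y - 1).
Proof.
rewrite le_eqVlt => /predU1P[<-|x0] y0; first by rewrite !mul0r addr0.
rewrite -mulrDr ler_pM2l// -lerBlDl -ln_div ?posrE//.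
rewrite -{1}[x / y](addrNK 1) addrC; apply: le_ln1Dx.
by rewrite ltrBDr addNr divr_gt0.
Qed.

(** Entropy is at most variance divided by mean: [xlnx_le] is applied to both values with [y] the
    mean. *)
Lemma two_point_entropy (A B : R) : 0 <= A -> 0 <= B ->
  (A * ln A + B * ln B) / 2 - (A + B) / 2 * ln ((A + B) / 2)
  <= (A - B) ^+ 2 / (2 * (A + B)).
Proof.
move=> A0 B0; have [AB|AB] := eqVneq (A + B) 0.
  have -> : A = 0 by lra.
  have -> : B = 0 by lra.
  by rewrite !(mul0r, addr0, subrr, expr0n).
have m0 : 0 < (A + B) / 2 by rewrite divr_gt0// lt_neqAle eq_sym AB addr_ge0.
have := xlnx_le A0 m0; have := xlnx_le B0 m0.
set l := ln (_ / 2) => h1 h2.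
have -> : (A - B) ^+ 2 / (2 * (A + B)) = (A * (A / ((A + B) / 2) - 1) +
   B * (B / ((A + B) / 2) - 1)) / 2.
  by field; rewrite AB.
lra.
Qed.

Definition entropy_sqr n u := avg n (fun s => u s ^+ 2 * ln (u s ^+ 2))
  - avg n (fun s => u s ^+ 2) * ln (avg n (fun s => u s ^+ 2)).

(** Chain rule for entropy: splitting off the first bit leaves the mean entropy of the two halves,
    handled by induction, and the two-point entropy of their second moments [A0] and [A1]. The
    constant is twice the sharp one, which is enough here. *)
Lemma log_sobolev n u : entropy_sqr n u <= energy n u.
Proof.
elim: n u => [|n IH] u.
  by rewrite /entropy_sqr /energy big_ord0 /= subrr.
rewrite energyS /entropy_sqr /=.
have := IH (fun s => u (false :: s)); have := IH (fun s => u (true :: s)).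
rewrite /entropy_sqr.
set L1 := avg n _; set A1 := avg n _; set E1 := energy n _ => h1.
set L0 := avg n _; set A0 := avg n _; set E0 := energy n _ => h0.
have A00 : 0 <= A0 by apply: avg_ge0 => s _; rewrite sqr_ge0.
have A10 : 0 <= A1 by apply: avg_ge0 => s _; rewrite sqr_ge0.
have tp := two_point_entropy A00 A10.
set D := avg n _.
suff : (A0 - A1) ^+ 2 / (2 * (A0 + A1)) <= D.
  by move: tp; rewrite -/A0 -/A1; lra.
have D0 : 0 <= D by apply: avg_ge0 => s _; rewrite sqr_ge0.
have [A01|A01] := eqVneq (A0 + A1) 0; first by rewrite A01 mulr0 invr0 mulr0.
rewrite ler_pdivrMr; last by rewrite mulr_gt0// lt_neqAle eq_sym A01 addr_ge0.
(* A difference of squares is factored; Cauchy-Schwarz and [(a + b) ^ 2 <= 2 * (a ^ 2 + b ^ 2)] then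
   finish. *)
have -> : (A0 - A1) = avg n (fun s => (u (true :: s) - u (false :: s)) *
   ((-1) * (u (true :: s) + u (false :: s)))).
  by rewrite /A0 /A1 -avgB; apply: eq_avg => s _; ring.
apply: le_trans (avg_cauchy_schwarz _ _ _) _.
apply: ler_wpM2l => //.
rewrite /A0 /A1 -avgD -avgZ; apply: ler_avg => s _.
have := sqr_ge0 (u (true :: s) - u (false :: s)).
by rewrite -subr_ge0 => H; rewrite -subr_ge0; move: H; lra.
Qed.

(* This dual form of [Ent (u^2) >= |u|_2^2 ln (|u|_2^2 / |u|_1^2)] is linear
   in [|u|_2^2], so that it can be summed over martingale differences. *)
Lemma entropy_sqr_ge n u (t : R) : 0 < t ->
  avg n (fun s => u s ^+ 2) * (1 + ln t) - t * avg n (fun s => `|u s|) ^+ 2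
  <= entropy_sqr n u.
Proof.
move=> t0; rewrite /entropy_sqr.
(* Pointwise in [y = |u s|], this is [ln x <= ln y + x / y - 1] multiplied by [2 * y ^ 2]. *)
have H (x : R) : 0 < x -> avg n (fun s => u s ^+ 2) * (2 * ln x + 2)
    - 2 * x * avg n (fun s => `|u s|) <= avg n (fun s => u s ^+ 2 * ln (u s ^+ 2)).
  move=> x0; rewrite mulrC -!avgZ -avgB; apply: ler_avg => s _.
  rewrite -real_normK ?num_real//.
  have := normr_ge0 (u s); rewrite le_eqVlt => /predU1P[<-|y0].
    by rewrite expr0n/= !mulr0 mul0r subrr.
  rewrite lnXn// -mulr_natl.
  have := xlnx_le (ltW x0) y0; move: y0; set y := `|u s|.
  move=> y0 xy.
  have {}xy : ln x <= ln y + x / y - 1.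
    by rewrite -(ler_pM2l x0); move: xy; lra.
  have : (x / y) * y = x by rewrite divfK// gt_eqF.
  move: xy; set z := x / y => xy zy.
  have : 0 <= (ln y + z - 1 - ln x) * y ^+ 2.
    by rewrite mulr_ge0// ?sqr_ge0// subr_ge0.
  have -> : (ln y + z - 1 - ln x) * y ^+ 2 =
     y ^+ 2 * ln y + (z * y) * y - y ^+ 2 - ln x * y ^+ 2 by ring.
  rewrite zy; lra.
have v0 : 0 <= avg n (fun s => u s ^+ 2).
  by apply: avg_ge0 => s _; rewrite sqr_ge0.
have a0 : 0 <= avg n (fun s => `|u s|) by apply: avg_ge0.
move: H v0 a0; set v := avg n _; set a := avg n _; set L := avg n _ => H v0 a0.
move: v0; rewrite le_eqVlt => /predU1P[v0|v0].
  rewrite -v0 !mul0r subr0 sub0r.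
  move: a0; rewrite le_eqVlt => /predU1P[az|a0].
    by have := H 1 ltr01; rewrite -az -v0; lra.
  have /H : 0 < t * a / 2 by rewrite divr_gt0// mulr_gt0.
  by rewrite -v0; lra.
have vt0 : 0 < v * t by rewrite mulr_gt0.
(* With this [x], [2 * ln x = ln v + ln t]: the term [v * ln v] cancels, and what remains is the
   square of [x - t * a] divided by [t]. *)
have /H : 0 < Num.sqrt (v * t) by rewrite sqrtr_gt0.
have vt : v * t = Num.sqrt (v * t) ^+ 2 by rewrite sqr_sqrtr// ltW.
have lnvt : ln v + ln t = 2 * ln (Num.sqrt (v * t)).
  by rewrite -lnM ?posrE// {1}vt lnXn ?sqrtr_gt0// mulr_natl.
move: lnvt vt; set l := ln (Num.sqrt _); set x := Num.sqrt _ => lnvt vt.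
have : 0 <= t * (v - 2 * x * a + t * a ^+ 2).
  suff -> : t * (v - 2 * x * a + t * a ^+ 2) = (x - t * a) ^+ 2 by rewrite sqr_ge0.
  by rewrite !mulrDr [t * v]mulrC vt; ring.
rewrite pmulr_rge0// -lnvt.
lra.
Qed.

(* Average out the first bit, [h = hm + d] with [|d| = |u|]: the variance and
   the energy both split orthogonally, and log-Sobolev is applied to [u]. *)
Lemma kkl_energy n h (delta t : R) : 0 < t ->
  (forall k, (k < n)%N -> abs_infl n k h <= delta) ->
  cube_var n h * (1 + ln t)
  <= energy n h + t * delta * \sum_(k < n) abs_infl n k h.
Proof.
move=> t0; elim: n h => [|n IH] h hd.
  by rewrite /cube_var /energy !big_ord0 /= subrr mul0r mulr0 addr0.
pose hm s := (h (false :: s) + h (true :: s)) / 2.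
pose u s := (h (true :: s) - h (false :: s)) / 2.
(* Averaging out a bit does not increase the other influences, so the induction hypothesis applies
   to [hm] with the same [delta]. *)
have hdm k : (k < n)%N -> abs_infl n k hm <= abs_infl n.+1 k.+1 h.
  move=> kn; rewrite /abs_infl /= -avgD mulrC -avgZ; apply: ler_avg => s _.
  rewrite /hm.
  have -> : (h (false :: s) + h (true :: s)) / 2
    - (h (false :: flip_bit k s) + h (true :: flip_bit k s)) / 2
    = 2^-1 * ((h (false :: s) - h (false :: flip_bit k s))
        + (h (true :: s) - h (true :: flip_bit k s))) by lra.
  rewrite normrM ger0_norm ?invr_ge0//.
  by rewrite ler_pM2l ?invr_gt0// ler_normD.
have IHm := IH hm (fun k kn => le_trans (hdm k kn) (hd k.+1 kn)).
have LS := le_trans (entropy_sqr_ge n u t0) (log_sobolev n u).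
have varE : cube_var n.+1 h = cube_var n hm + avg n (fun s => u s ^+ 2).
  rewrite /cube_var /=.
  have -> : avg n hm = (avg n (fun s => h (false :: s)) +
      avg n (fun s => h (true :: s))) / 2.
    by rewrite -avgD [RHS]mulrC -avgZ; apply: eq_avg => s _; rewrite /hm mulrC.
  rewrite addrAC -avgD; congr (_ - _).
  by rewrite -avgD mulrC -avgZ; apply: eq_avg => s _; rewrite /hm /u; field.
(* Parallelogram identity in each direction except the first, whose energy is dropped. *)
have enE : energy n hm + energy n u <= energy n.+1 h.
  rewrite energyS -[leLHS]add0r lerD//.
    by apply: avg_ge0 => s _; rewrite sqr_ge0.
  rewrite le_eqVlt; apply/orP; left; apply/eqP.
  rewrite /energy -!big_split /= mulr_suml; apply: eq_bigr => k _.
  rewrite -!avgD [RHS]mulrC -avgZ; apply: eq_avg => s _.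
  by rewrite /hm /u; field.
have d0 : abs_infl n.+1 0 h = 2 * avg n (fun s => `|u s|).
  rewrite /abs_infl /= -avgD mulrC -!avgZ; apply: eq_avg => s _.
  rewrite /u [`|_ - h (true :: s)|]distrC normrM [`|2^-1|]ger0_norm ?invr_ge0//.
  lra.
have a0 : 0 <= avg n (fun s => `|u s|) by apply: avg_ge0.
have d1 := hd 0 isT.
have sumE : \sum_(k < n) abs_infl n k hm <= \sum_(k < n) abs_infl n.+1 k.+1 h.
  by apply: ler_sum => k _; exact: hdm.
rewrite big_ord_recl /= d0.
under eq_bigr do rewrite /bump leq0n add1n.
move: d1 a0 sumE LS IHm enE; rewrite d0 varE.
set a := avg n _; set v := avg n _; set S := \sum_(k < n) _; set S' := \sum_(k < n) _.
set l := ln t => d1 a0 sumE LS IHm enE.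
have : 0 <= t * delta * (S' - S).
  by rewrite mulr_ge0 ?subr_ge0// mulr_ge0 ?(ltW t0)//; lra.
(* The influence of the first bit is [2 * a <= delta]: one factor [a] is traded for [delta], the
   other is kept for the sum. *)
have : t * a ^+ 2 <= t * delta * (2 * a).
  rewrite -mulrA ler_pM2l// expr2.
  have : 0 <= (delta - 2 * a) * a by rewrite mulr_ge0 ?subr_ge0.
  have : 0 <= a * a by rewrite mulr_ge0.
  lra.
lra.
Qed.

End cube.

(** * Cylinders and the invariance of the uniform measure under flips *)

Definition prefix_of (n : nat) (w : Omega) : seq bool := mkseq w n.

Definition cylinder (s : seq bool) : set Omega :=
  [set w | prefix_of (size s) w = s].

Lemma prefix_ofS n w : prefix_of n.+1 w = rcons (prefix_of n w) (w n).
Proof. by rewrite /prefix_of /mkseq -addn1 iotaD map_cat cats1. Qed.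

Lemma cylinderE s :
  cylinder s = [set w | forall i, (i < size s)%N -> w i = nth false s i].
Proof.
apply/seteqP; split => w /=.
  by move=> ws i si; rewrite -[in RHS]ws nth_mkseq.
move=> H; apply: (@eq_from_nth _ false); first by rewrite size_mkseq.
by move=> i; rewrite size_mkseq => si; rewrite nth_mkseq// H.
Qed.

Lemma cylinder_rcons s b :
  cylinder (rcons s b) = cylinder s `&` [set w | w (size s) = b].
Proof.
rewrite /cylinder size_rcons; apply/seteqP; split => w /=.
  by rewrite prefix_ofS => /rcons_inj[].
by rewrite prefix_ofS => -[-> ->].
Qed.

Lemma measurable_coord n b : measurable ([set w | w n = b] : set Omega).
Proof. by apply: sub_sigma_algebra; exists n, b. Qed.

(** Any [S] is allowed because a prefix of length [n] takes finitely many values; the induction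
    splits on the last bit. *)
Lemma measurable_prefix n (S : set (seq bool)) :
  measurable ([set w | S (prefix_of n w)] : set Omega).
Proof.
elim: n S => [|n IH] S.
  have [S0|S0] := pselect (S [::]).
    by rewrite [X in measurable X](_ : _ = setT)//; apply/seteqP; split.
  by rewrite [X in measurable X](_ : _ = set0)//; apply/seteqP; split.
rewrite [X in measurable X](_ : _ =
    ([set w : Omega | S (rcons (prefix_of n w) true)] `&` [set w | w n = true])
    `|` ([set w : Omega | S (rcons (prefix_of n w) false)] `&` [set w | w n = false])).
  apply: measurableU; apply: measurableI; try exact: measurable_coord.
    exact: (IH [set s | S (rcons s true)]).
  exact: (IH [set s | S (rcons s false)]).
apply/seteqP; split => w /=; rewrite prefix_ofS.
  by case: (w n); [left|right].
by move=> [[+ ->]|[+ ->]].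
Qed.

Lemma measurable_cylinder s : measurable (cylinder s).
Proof. exact: (measurable_prefix (size s) [set s]). Qed.

Lemma prefix_flip k n w : (k < n)%N ->
  prefix_of n (flip k w) = flip_bit k (prefix_of n w).
Proof.
rewrite /prefix_of /mkseq => kn.
(* The start [m] is generalised because the tail of [iota m n] starts at [m.+1]. *)
suff H m : map (flip k w) (iota m n) =
   if (m <= k < m + n)%N then flip_bit (k - m) (map w (iota m n)) else map w (iota m n).
  by rewrite H subn0 kn.
move=> {kn}; elim: n m => [|n IH] m /=; first by case: ifP.
rewrite IH {IH} /flip addnS ltnS.
have [->|mk] := eqVneq m k.
  by rewrite ltnn leqnn leq_addr subnn.
case: (ltngtP m k) mk => // mk _.
case: ifP => // _.
by rewrite subnS; case: (k - m)%N (subn_gt0 m k) mk => [<-|].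
Qed.

Lemma prefix_flip_ge k n w : (n <= k)%N -> prefix_of n (flip k w) = prefix_of n w.
Proof.
move=> nk; apply/eq_in_map => i; rewrite mem_iota add0n => /= ik.
by rewrite /flip ltn_eqF// (leq_trans ik).
Qed.

Lemma size_flip_bit k s : size (flip_bit k s) = size s.
Proof. by elim: s k => [|b s IH] [|k] //=; rewrite IH. Qed.

Lemma flip_bitK k : involutive (flip_bit k).
Proof. by move=> s; elim: s k => [|b s IH] [|k] //=; rewrite ?negbK ?IH. Qed.

Lemma flip_cylinder k s : (k < size s)%N ->
  flip k @^-1` cylinder (flip_bit k s) = cylinder s.
Proof.
move=> ks; rewrite /cylinder size_flip_bit; apply/seteqP; split => w /=.
  by rewrite prefix_flip// => /(can_inj (flip_bitK k)).
by rewrite prefix_flip// => ->.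
Qed.

Lemma flip_cylinder_ge k s : (size s <= k)%N ->
  flip k @^-1` cylinder s = cylinder s.
Proof.
by move=> ks; rewrite /cylinder; apply/seteqP; split => w /=; rewrite prefix_flip_ge.
Qed.

Lemma measurable_flip k : measurable_fun [set: Omega] (flip k : Omega -> Omega).
Proof.
apply: (@measurability _ _ Omega Omega setT _ (coord_sets : set (set Omega))).
  by [].
move=> _ [_ [n [b ->]] <-].
rewrite setTI [X in measurable X](_ : _ =
  [set w | w n = if n == k then ~~ b else b]); first exact: measurable_coord.
apply/seteqP; split => w /=; rewrite /flip; case: ifP => // _.
  by move=> <-; rewrite negbK.
by move=> ->; rewrite negbK.
Qed.

Section probability_of_prefixes.
Variable P : probability Omega RR.

Definition pr (A : set Omega) : RR := fine (P A).

Lemma prE A : measurable A -> P A = (pr A)%:E.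
Proof. by move=> mA; rewrite fineK// fin_num_measure. Qed.

Lemma pr_ge0 A : 0 <= pr A.
Proof. by rewrite /pr fine_ge0. Qed.

Lemma le_pr A B : measurable A -> measurable B -> A `<=` B -> pr A <= pr B.
Proof. by move=> mA mB AB; rewrite -lee_fin -!prE// le_measure ?inE. Qed.

Lemma prID A B : measurable A -> measurable B ->
  pr A = pr (A `&` B) + pr (A `&` ~` B).
Proof.
move=> mA mB.
have mC := measurableC mB.
apply: EFin_inj; rewrite EFinD -!prE//; try exact: measurableI.
rewrite -measureU; [| exact: measurableI | exact: measurableI |].
  by rewrite -setIUr setUv setIT.
by rewrite setIACA setICr setI0.
Qed.

Lemma prT : pr setT = 1.
Proof. by rewrite /pr probability_setT. Qed.

Lemma pr_le1 A : measurable A -> pr A <= 1.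
Proof. by move=> mA; rewrite -lee_fin -prE// probability_le1. Qed.

Lemma prU_le A B : measurable A -> measurable B -> pr (A `|` B) <= pr A + pr B.
Proof.
move=> mA mB; rewrite (@prID (A `|` B) A)//; last exact: measurableU.
have mU := measurableU A B mA mB; have mC := measurableC mA.
apply: lerD; apply: le_pr => //; try exact: measurableI.
by move=> w [[]].
Qed.

(** Law of total probability over the extensions of [p] by [n] bits; the factor [2 ^+ n] undoes the
    normalisation of [avg]. It transfers estimates from the cube to [P]. *)
Lemma avg_pr_cylinder n p A : measurable A ->
  avg n (fun s => 2 ^+ n * pr (cylinder (p ++ s) `&` A)) = pr (cylinder p `&` A).
Proof.
move=> mA; elim: n p => [|n IH] p; first by rewrite /= expr0 mul1r cats0.
rewrite /= (@prID (cylinder p `&` A) [set w | w (size p) = true]); first last.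
- exact: measurable_coord.
- by apply: measurableI => //; exact: measurable_cylinder.
have H b : avg n (fun s => 2 ^+ n.+1 * pr (cylinder (p ++ b :: s) `&` A))
    = 2 * pr (cylinder (rcons p b) `&` A).
  by rewrite -IH -avgZ; apply: eq_avg => s _; rewrite -cat_rcons exprS mulrA.
rewrite !H !cylinder_rcons.
have -> : ~` [set w : Omega | w (size p) = true] = [set w | w (size p) = false].
  by apply/seteqP; split => w /=; case: (w _).
rewrite ![cylinder p `&` _ `&` A]setIAC.
lra.
Qed.

Lemma avg_pr n A : measurable A -> avg n (fun s => 2 ^+ n * pr (cylinder s `&` A)) = pr A.
Proof.
move=> mA; have := avg_pr_cylinder n [::] mA => /= ->.
by congr pr; apply/seteqP; split => // w [].
Qed.

End probability_of_prefixes.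

(** The events depending on finitely many bits form a generating pi-system [G], and [avg_pr]
    computes their probabilities from those of cylinders. *)
Lemma uniform_product_unique (P Q : probability Omega RR) :
  uniform_product P -> uniform_product Q -> forall A, measurable A -> P A = Q A.
Proof.
move=> uP uQ.
have PQ s : pr P (cylinder s) = pr Q (cylinder s).
  by rewrite cylinderE /pr uP uQ.
pose G : set (set Omega) :=
  [set A | exists n (S : set (seq bool)), A = [set w | S (prefix_of n w)]].
apply: (@measure_unique _ _ _ G (fun=> setT)).
- apply/seteqP; split.
    apply: smallest_sub; first exact: smallest_sigma_algebra.
    move=> _ [n [b ->]]; apply: sub_sigma_algebra.
    exists n.+1, [set s | nth false s n = b]; apply/seteqP; split=> w /=;
      by rewrite /prefix_of nth_mkseq.
  apply: smallest_sub; first exact: sigma_algebra_measurable.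
  by move=> _ [n [S ->]]; exact: measurable_prefix.
- move=> _ _ [n [S ->]] [m [T ->]].
  exists (maxn n m), [set s | S (take n s) /\ T (take m s)].
  have H w i : (i <= maxn n m)%N -> take i (prefix_of (maxn n m) w) = prefix_of i w.
    by move=> im; rewrite /prefix_of /mkseq -map_take take_iota (minn_idPl im).
  by apply/seteqP; split => w /=; rewrite !H ?leq_maxl ?leq_maxr.
- by move=> _; exists 0%N, setT.
- by rewrite bigcup_const.
- move=> _ [n [S ->]]; have mS := measurable_prefix n S.
  apply: etrans (prE P mS) (etrans _ (esym (prE Q mS))).
  congr EFin; rewrite -(avg_pr P n mS) -(avg_pr Q n mS).
  apply: eq_avg => s sn; congr (_ * _).
  have [Ss|Ss] := pselect (S s).
    suff -> : cylinder s `&` [set w | S (prefix_of n w)] = cylinder s by [].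
    by apply/seteqP; split => w /=; [case | rewrite /cylinder /= sn => ->].
  suff -> : cylinder s `&` [set w | S (prefix_of n w)] = set0 by rewrite /pr !measure0.
  by apply/seteqP; split => w //= [+ Sw]; rewrite /cylinder /= sn => sw; case: Ss; rewrite -sw.
- by move=> _; rewrite (le_lt_trans (probability_le1 _ _))// ltry.
Qed.

(** The image of [P] under [flip k] is again uniform, since flipping permutes the cylinders of each
    length above [k] and fixes the shorter ones; uniqueness concludes. *)
Lemma pr_flip (P : probability Omega RR) k A : uniform_product P -> measurable A ->
  pr P (flip k @^-1` A) = pr P A.
Proof.
move=> uP mA.
have mf : measurable_fun setT (flip k : Omega -> Omega) := measurable_flip k.
pose fk : {mfun Omega >-> Omega} := HB.pack (flip k : Omega -> Omega)
  (isMeasurableFun.Build _ _ _ _ _ mf).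
have uQ : uniform_product (distribution P fk).
  move=> s; rewrite -cylinderE.
  transitivity (P (flip k @^-1` cylinder s)); first by [].
  have [ks|ks] := ltnP k (size s); last by rewrite flip_cylinder_ge// cylinderE uP.
  by rewrite -{1}[s](flip_bitK k) flip_cylinder ?size_flip_bit// cylinderE uP size_flip_bit.
by rewrite /pr -(uniform_product_unique uQ uP mA).
Qed.

(** * The least witness set *)

Lemma measurable_preim (f : Omega -> bool) (g : pred bool) :
  boolean_function f -> measurable ([set w | g (f w)] : set Omega).
Proof.
by move=> mf; rewrite -[X in measurable X]setTI; exact: (mf measurableT [set b | g b]).
Qed.

Section determination.
Variables (P : probability Omega RR) (f : Omega -> bool).
Hypothesis mf : boolean_function f.

(** A visibly measurable form of the statement that the first [n] coordinates are a witness set: the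
    almost sure event of [witness] becomes a null set condition on the prefix. *)
Definition determined n : set Omega :=
  [set w | pr P (cylinder (prefix_of n w) `&` [set w' | f w' != f w]) = 0].

Lemma measurable_determined n : measurable (determined n).
Proof.
pose S b : set (seq bool) := [set s | pr P (cylinder s `&` [set w | f w != b]) = 0].
rewrite [X in measurable X](_ : _ =
  ([set w | f w == true] `&` [set w | S true (prefix_of n w)]) `|`
  ([set w | f w == false] `&` [set w | S false (prefix_of n w)])).
  apply: measurableU; apply: measurableI; try exact: measurable_prefix.
    exact: (measurable_preim (pred1 true) mf).
  exact: (measurable_preim (pred1 false) mf).
apply/seteqP; split => w; rewrite /determined /S /=.
  by case: (f w) => H; [left|right].
by case=> -[/eqP -> ].
Qed.

Lemma measurable_cylinder_neq s b : measurable (cylinder s `&` [set w | f w != b]).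
Proof.
apply: measurableI; first exact: measurable_cylinder.
exact: (measurable_preim (predC1 b) mf).
Qed.

Lemma determinedS n m : (n <= m)%N -> determined n `<=` determined m.
Proof.
move=> nm w; rewrite /determined /= => H.
apply/eqP; rewrite eq_le pr_ge0 andbT -H; apply: le_pr;
  try exact: measurable_cylinder_neq.
apply: setSI => w'; rewrite /cylinder /= !size_mkseq => ww'.
have T v : take n (prefix_of m v) = prefix_of n v.
  by rewrite /prefix_of /mkseq -map_take take_iota (minn_idPl nm).
by rewrite -T ww' T.
Qed.

Lemma determined_witness n w : determined n w -> witness P f w [set i | i \in iota 0 n].
Proof.
move=> H; have mC := measurable_cylinder_neq (prefix_of n w) (f w).
exists (~` (cylinder (prefix_of n w) `&` [set w' | f w' != f w])); split.
  exact: measurableC.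
split.
  by rewrite probability_setC// prE// H sube0.
move=> w' /= /not_andP[nc|/negP/negPn/eqP//] ww'.
exfalso; apply: nc; rewrite /cylinder /= size_mkseq.
by apply/eq_in_map => i /ww'.
Qed.

Lemma leq_maxW i s : i \in s -> (i < maxW s)%N.
Proof. by move=> si; exact: (@leq_bigmax_seq _ _ predT (fun i => i.+1) i si). Qed.

(** A witness set may be enlarged to the initial segment that ends at its maximum. As [maxW] counts
    coordinates from 1, this segment is [iota 0 (maxW s)]. *)
Lemma witness_determined w s : witness P f w [set i | i \in s] -> determined (maxW s) w.
Proof.
move=> [A [mA [PA H]]]; rewrite /determined /=.
have PC : pr P (~` A) = 0.
  by rewrite /pr probability_setC// PA subee.
apply/eqP; rewrite eq_le pr_ge0 andbT -PC; apply: le_pr.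
- exact: measurable_cylinder_neq.
- exact: measurableC.
move=> w' [+ /= fw'] Aw'; rewrite /cylinder /= size_mkseq => ww'.
move/eqP: fw'; apply; apply: H => // i /= si.
move/(congr1 (fun s => nth false s i)): ww'.
by rewrite !nth_mkseq ?leq_maxW.
Qed.

Lemma maxW_iota n : maxW (iota 0 n) = n.
Proof.
apply/eqP; rewrite eqn_leq; apply/andP; split.
  rewrite /maxW; apply/bigmax_leqP_seq => i; rewrite mem_iota.
  by move=> /andP[_]; rewrite add0n.
by case: n => // n; apply: leq_maxW; rewrite mem_iota /= add0n.
Qed.

(** Lexicographic order is well founded only at bounded length, whence the fixed size [m]. The least
    head is chosen first, then the least tail. *)
Lemma exists_lex_least m (Q : set (seq nat)) :
  (exists s, Q s) -> (forall s, Q s -> size s = m) ->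
  exists s, Q s /\ forall t, Q t -> t = s \/ lex_lt s t.
Proof.
elim: m Q => [|m IH] Q [s0 Qs0] Qm.
  exists s0; split => // t Qt; left.
  by rewrite (size0nil (Qm _ Qt)) (size0nil (Qm _ Qs0)).
have ex : exists x, `[< exists s, Q (x :: s) >].
  move: s0 Qs0 (Qm _ Qs0) => [//|x s0] Qs0 _.
  by exists x; apply/asboolP; exists s0.
case: (ex_minnP ex) => x /asboolP Qx xmin.
have [||s [Qs smin]] := IH [set s | Q (x :: s)]; first exact: Qx.
  by move=> s /Qm[].
exists (x :: s); split => // -[|y t] Qt; first by have := Qm _ Qt.
have := xmin y; rewrite leq_eqVlt => /(_ _)/orP[|/eqP xy|xy] /=.
- by apply/asboolP; exists t.
- move: Qt; rewrite -xy => /smin [->|st]; first by left.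
  by right; rewrite ltnn eqxx.
- by right; rewrite xy.
Qed.

(** Successive minimisation of the maximum, the size and the lexicographic rank; [iota 0 n] shows
    that there are candidates. *)
Lemma exists_least_witness w n : determined n w ->
  (forall m, determined m w -> (n <= m)%N) ->
  exists s, least_witness P f w s.
Proof.
move=> dn nmin.
pose Q1 := [set s | fin_nat_set s /\ witness P f w [set i | i \in s] /\ maxW s = n].
have ex1 : exists m, `[< exists s, Q1 s /\ size s = m >].
  exists (size (iota 0 n)); apply/asboolP; exists (iota 0 n); split => //.
  split; first exact: iota_ltn_sorted.
  by split; [exact: determined_witness | exact: maxW_iota].
case: (ex_minnP ex1) => m /asboolP exm mmin.
have [||s [[[fs [ws Ms]] sm] smin]] :=
    @exists_lex_least m [set s | Q1 s /\ size s = m]; first exact: exm.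
  by move=> s [].
exists s; split => //; split => // t ft wt.
have := nmin _ (witness_determined wt).
rewrite /wit_lt Ms leq_eqVlt => /orP[/eqP tn|->]; last by right.
rewrite -tn ltnn eqxx /= sm.
have := mmin (size t); rewrite leq_eqVlt => /(_ _)/orP[|/eqP mt|->].
- by apply/asboolP; exists t.
- rewrite -mt ltnn eqxx /=; apply: smin.
  by split.
- by right.
Qed.

(** This replaces the choice in [Wf] by measurable events. The second conjunct excludes the points
    without finite witness, where [Wf] is [[::]] and its maximum 0. *)
Lemma ltn_maxWf k w :
  (k < maxW (Wf P f w))%N <-> (~ determined k w /\ exists n, determined n w).
Proof.
have [[n0 dn0]|nodet] := pselect (exists n, determined n w); last first.
  split=> [|[]//]; rewrite /Wf xgetPN ?/maxW ?big_nil// => s [_ [ws _]].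
  by apply: nodet; exists (maxW s); exact: witness_determined.
have ex : exists n, `[< determined n w >] by exists n0; apply/asboolP.
case: (ex_minnP ex) => n /asboolP dn nmin.
have [|s ls] := exists_least_witness dn.
  by move=> m dm; apply: nmin; apply/asboolP.
have {s ls} := xgetPex [::] (ex_intro _ s ls); rewrite -/(Wf P f w).
set s := Wf P f w => -[fs [ws smin]]; split => [ks|[ndk _]].
  split; last by exists n0.
  move=> /determined_witness dk; have := smin _ (iota_ltn_sorted 0 k) dk.
  case=> [sk|]; first by move: ks; rewrite -sk maxW_iota ltnn.
  rewrite /wit_lt maxW_iota => /orP[|/andP[/eqP sk _]].
    by move=> /(ltn_trans ks); rewrite ltnn.
  by move: ks; rewrite sk ltnn.
rewrite ltnNge; apply/negP => sk; apply: ndk.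
exact: (determinedS sk (witness_determined ws)).
Qed.

End determination.

(** * Conditional expectations given the first bits *)

Section truncation.
Variables (P : probability Omega RR) (f : Omega -> bool).
Hypotheses (uP : uniform_product P) (mf : boolean_function f).

Let F : set Omega := [set w | f w].

Let mF : measurable F.
Proof. exact: (measurable_preim id mf). Qed.

Lemma measurable_sensitive k : measurable ([set w | f (flip k w) != f w] : set Omega).
Proof.
have mG : measurable (flip k @^-1` F).
  by have := measurable_flip k measurableT mF; rewrite setTI.
rewrite [X in measurable X](_ : _ =
  (flip k @^-1` F `&` ~` F) `|` (~` (flip k @^-1` F) `&` F)).
  by apply: measurableU; apply: measurableI => //; exact: measurableC.
apply/seteqP; split => w; rewrite /F /=; case: (f _); case: (f w) => //=.
- by left.
- by right.
- by case=> -[].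
- by case=> -[].
Qed.

Lemma influence_ge0 k : 0 <= influence P f k.
Proof. exact: pr_ge0. Qed.

Lemma influence_le1 k : influence P f k <= 1.
Proof. by apply: pr_le1; exact: measurable_sensitive. Qed.

Lemma influence_le_sup k : influence P f k <= sup (range (influence P f)).
Proof.
apply: ub_le_sup; last by exists k.
by exists 1 => _ [j _ <-]; exact: influence_le1.
Qed.

(** For [size s = n], the conditional probability that [f] is +1 given the prefix [s]. Values in
    [0, 1] replace the signs, at the cost of the factor 4 in [VarE]. *)
Definition cond_prob n (s : seq bool) : RR := 2 ^+ n * pr P (cylinder s `&` F).

Lemma pr_cylinder s : pr P (cylinder s) = 2 ^- size s.
Proof. by rewrite cylinderE /pr uP. Qed.

Lemma cond_prob_ge0 n s : 0 <= cond_prob n s.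
Proof. by rewrite mulr_ge0// ?exprn_ge0// pr_ge0. Qed.

Lemma cond_prob_le1 n s : size s = n -> cond_prob n s <= 1.
Proof.
move=> sn; have <- : 2 ^+ n * 2 ^- n = 1 :> RR by rewrite mulfV// expf_neq0.
rewrite /cond_prob ler_pM2l ?exprn_gt0// -sn -pr_cylinder.
apply: le_pr => //; last exact: measurable_cylinder.
by apply: measurableI => //; exact: measurable_cylinder.
Qed.

Lemma dist_pr_le (C A B D : set Omega) :
  measurable C -> measurable A -> measurable B -> measurable D ->
  A `&` ~` B `<=` D -> B `&` ~` A `<=` D ->
  `|pr P (C `&` A) - pr P (C `&` B)| <= pr P (C `&` D).
Proof.
move=> mC mA mB mD ABD BAD.
have H (A' B' : set Omega) : measurable A' -> measurable B' -> A' `&` ~` B' `<=` D ->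
    pr P (C `&` A') <= pr P (C `&` B') + pr P (C `&` D).
  move=> mA' mB' ABD'.
  have mCA := measurableI _ _ mC mA'; have mCB := measurableI _ _ mC mB'.
  have mCD := measurableI _ _ mC mD.
  apply: le_trans _ (prU_le P mCB mCD); apply: le_pr => //; first exact: measurableU.
  move=> w [Cw Aw]; have [Bw|Bw] := pselect (B' w); first by left.
  by right; split => //; apply: ABD'.
by rewrite ler_distlC lerBlDr !H.
Qed.

(** By invariance under [flip k], the value at the flipped prefix is a probability on the same
    cylinder, so the difference is bounded by the mass of the sensitive points there. *)
Lemma abs_infl_cond_prob n k : (k < n)%N ->
  abs_infl n k (cond_prob n) <= influence P f k.
Proof.
move=> kn; have mG := measurable_sensitive k.
rewrite /influence -[fine _]/(pr P _) -(avg_pr P n mG).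
apply: ler_avg => s sn; rewrite /cond_prob -mulrBr normrM ger0_norm ?exprn_ge0//.
rewrite ler_pM2l ?exprn_gt0//.
have mH : measurable (flip k @^-1` F).
  by have := measurable_flip k measurableT mF; rewrite setTI.
have -> : pr P (cylinder (flip_bit k s) `&` F) = pr P (cylinder s `&` flip k @^-1` F).
  rewrite -(pr_flip k uP).
    by rewrite preimage_setI flip_cylinder// sn.
  by apply: measurableI => //; exact: measurable_cylinder.
apply: dist_pr_le => //; first exact: measurable_cylinder.
  by move=> w [] /=; rewrite /F /= => ->; case: (f _).
by move=> w [] /=; rewrite /F /= => ->; case: (f _).
Qed.

(** Differences of values in [0, 1] satisfy [x ^ 2 <= |x|]. *)
Lemma energy_le_abs_infl n :
  energy n (cond_prob n) <= \sum_(k < n) abs_infl n k (cond_prob n).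
Proof.
apply: ler_sum => k _; apply: ler_avg => s sn.
rewrite -real_normK ?num_real// expr2 ler_piMr//.
have := cond_prob_ge0 n s; have := cond_prob_le1 sn.
have sn' : size (flip_bit k s) = n by rewrite size_flip_bit.
have := cond_prob_ge0 n (flip_bit k s); have := cond_prob_le1 sn'.
move=> *; rewrite ler_norml; apply/andP; split; lra.
Qed.

(** On a prefix that almost surely decides [f], [cond_prob] is 0 or 1 and equals its square. Any
    other cylinder is entirely undetermined, so the second moment loses at most its mass. *)
Lemma variance_cond_prob n :
  pr P F * (1 - pr P F) - pr P (~` determined P f n) <= cube_var n (cond_prob n).
Proof.
have mdet := measurable_determined P mf n.
rewrite /cube_var avg_pr//.
suff : pr P F - pr P (~` determined P f n) <= avg n (fun s => cond_prob n s ^+ 2).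
  lra.
rewrite -(avg_pr P n mF) -(avg_pr P n (measurableC mdet)) -avgB.
apply: ler_avg => s sn; rewrite -/(cond_prob n s).
have h0 := cond_prob_ge0 n s; have h1 := cond_prob_le1 sn.
have mC := measurable_cylinder s.
have [dT|dT] := eqVneq (pr P (cylinder s `&` [set w | f w != true])) 0.
  suff -> : cond_prob n s = 1.
    by rewrite expr1n gerBl mulr_ge0 ?exprn_ge0 ?pr_ge0.
  rewrite /cond_prob; have := prID P mC mF.
  have -> : ~` F = [set w | f w != true].
    by apply/seteqP; split => w; rewrite /F /=; case: (f w).
  by rewrite dT addr0 => <-; rewrite pr_cylinder sn mulfV// expf_neq0.
have [dF|dF] := eqVneq (pr P (cylinder s `&` [set w | f w != false])) 0.
  suff -> : cond_prob n s = 0.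
    by rewrite expr0n /= sub0r oppr_le0 mulr_ge0 ?exprn_ge0 ?pr_ge0.
  rewrite /cond_prob (_ : F = [set w | f w != false]) ?dF ?mulr0//.
  by apply/seteqP; split => w; rewrite /F /=; case: (f w).
have -> : cylinder s `&` ~` determined P f n = cylinder s.
  apply/seteqP; split => w; first by case.
  move=> cw; split => //; rewrite /determined /= => dw; move: (cw) dw.
  rewrite /cylinder /= sn => ->.
  by case: (f w) => /eqP; [rewrite (negbTE dT)|rewrite (negbTE dF)].
rewrite pr_cylinder sn mulfV ?expf_neq0//.
have := sqr_ge0 (cond_prob n s); lra.
Qed.

Lemma integral_bool_fun (a b : RR) :
  (\int[P]_w (if f w then a else b)%:E = (a * pr P F + b * (1 - pr P F))%:E)%E.
Proof.
have mC := measurableC mF.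
rewrite -(setUv F) integral_setU//; last first.
- by rewrite disj_set2E setICr.
- by rewrite setUv; apply/measurable_EFinP; apply: measurable_fun_ifT.
have -> : (\int[P]_(w in F) (if f w then a else b)%:E = a%:E * P F)%E.
  rewrite -integral_cst//; apply: eq_integral => w; rewrite inE /F /= => -> //.
have -> : (\int[P]_(w in ~` F) (if f w then a else b)%:E = b%:E * P (~` F))%E.
  rewrite -integral_cst//; apply: eq_integral => w; rewrite inE /F /= => /negP/negbTE -> //.
by rewrite probability_setC// prE.
Qed.

Lemma VarE : Var P f = 4 * (pr P F * (1 - pr P F)).
Proof.
rewrite /Var /= /valR integral_bool_fun /=.
set m := _ + _.
under eq_integral => w _.
  rewrite (_ : ((if f w then 1 else -1) - m) ^+ 2 =
    if f w then (1 - m) ^+ 2 else (-1 - m) ^+ 2); last by case: (f w).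
  over.
by rewrite integral_bool_fun /= /m; ring.
Qed.

End truncation.

(** * Upper bound on the total influence *)

Section positive_part.
Variable R : realType.
Implicit Types (nu p : R) (k n m : nat).

Definition excess nu m : R := Num.max 0 (m%:R - nu).

(** Weight of the tail bound at [k]: 0 if [k + 1 <= nu], 1 if [nu <= k], and fractional in between,
    which accommodates a non-integer [nu]. *)
Definition excess_step nu k : R := excess nu k.+1 - excess nu k.

Lemma excess_step01 nu k : 0 <= excess_step nu k <= 1.
Proof.
rewrite /excess_step /excess -natr1.
by case: (leP 0 (k%:R + 1 - nu)); case: (leP 0 (k%:R - nu)); lra.
Qed.

Lemma excess0 nu : 0 <= nu -> excess nu 0 = 0.
Proof. by move=> nu0; rewrite /excess sub0r max_l// oppr_le0. Qed.

(** The sum telescopes to [excess nu (minn n m)]. *)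
Lemma sum_excess_step nu n m : 0 <= nu ->
  \sum_(k < n) excess_step nu k * (k < m)%:R <= excess nu m.
Proof.
move=> nu0.
suff -> : \sum_(k < n) excess_step nu k * (k < m)%:R = excess nu (minn n m).
  rewrite /excess ge_max le_max lexx /= le_max.
  by rewrite lerB ?orbT// ler_nat geq_minr.
elim: n => [|n IH]; first by rewrite big_ord0 min0n excess0.
rewrite big_ord_recr /= IH; case: (ltnP n m) => nm.
  by rewrite mulr1 (minn_idPl nm) addrC subrK.
by rewrite mulr0 addr0 (minn_idPr _)// leqW.
Qed.

Lemma sum_onem_excess_step nu n : 0 <= nu ->
  \sum_(k < n) (1 - excess_step nu k) <= nu.
Proof.
move=> nu0; suff -> : \sum_(k < n) (1 - excess_step nu k) = n%:R - excess nu n.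
  by rewrite /excess lerBlDr -lerBlDl le_max lexx orbT.
elim: n => [|n IH]; first by rewrite big_ord0 excess0// subrr.
by rewrite big_ord_recr /= IH /excess_step -natr1; ring.
Qed.

(** From [y ^ (p - 1) >= 1 + (p - 1) * ln y] and [ln y >= 1 - 1 / y], multiplied by [y]. *)
Lemma powR_ge_linear (y p : R) : 1 <= y -> 1 < p -> (p - 1) * (y - 1) <= y `^ p.
Proof.
move=> y1 p1; have y0 : 0 < y by lra.
rewrite -mulr_powRB1 ?(ltW y0)//; last lra.
have h1 : 1 + (p - 1) * ln y <= y `^ (p - 1).
  by rewrite /powR gt_eqF// expR_ge1Dx.
have h2 : 1 - y^-1 <= ln y.
  have : ln (y^-1) <= y^-1 - 1.
    by rewrite -{1}[y^-1](addrNK 1) addrC; apply: le_ln1Dx; rewrite ltrBDr addNr invr_gt0.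
  by rewrite lnV ?posrE//; lra.
have h3 : (p - 1) * (1 - y^-1) <= (p - 1) * ln y by rewrite ler_pM2l// subr_gt0.
have : y * ((p - 1) * (1 - y^-1)) <= y * y `^ (p - 1) by rewrite ler_pM2l//; lra.
rewrite (_ : y * ((p - 1) * (1 - y^-1)) = (p - 1) * (y - 1))//.
by field; rewrite gt_eqF.
Qed.

(** The case [m >= nu] is [powR_ge_linear] at [y = m / nu], rescaled by [nu / (p - 1)]. *)
Lemma excess_le_powR nu p m : 0 < nu -> 1 < p ->
  excess nu m <= nu * (p - 1)^-1 / nu `^ p * m%:R `^ p.
Proof.
move=> nu0 p1; have p10 : 0 < p - 1 by rewrite subr_gt0.
rewrite /excess; case: (leP 0 (m%:R - nu)) => mnu; last first.
  by rewrite !mulr_ge0 ?invr_ge0 ?powR_ge0// ltW.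
have y1 : 1 <= m%:R / nu by rewrite ler_pdivlMr// mul1r -subr_ge0.
have := powR_ge_linear y1 p1.
rewrite powRM ?invr_ge0 ?ler0n ?(ltW nu0)//.
rewrite -[nu^-1 in X in _ <= X -> _]powR_inv1 ?(ltW nu0)// -powRrM mulN1r powRN => H.
have : nu * (p - 1)^-1 * ((p - 1) * (m%:R / nu - 1)) <=
  nu * (p - 1)^-1 * (m%:R `^ p / nu `^ p).
  by rewrite ler_pM2l// divr_gt0.
have -> : nu * (p - 1)^-1 * ((p - 1) * (m%:R / nu - 1)) = m%:R - nu.
  by field; rewrite !gt_eqF.
by rewrite -!mulrA [m%:R `^ p / _]mulrC !mulrA.
Qed.

Lemma ln_div_le (nu : R) : 0 < nu -> ln nu / nu <= 2 / Num.sqrt nu.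
Proof.
move=> nu0; have r0 : 0 < Num.sqrt nu by rewrite sqrtr_gt0.
have : nu = Num.sqrt nu ^+ 2 by rewrite sqr_sqrtr// ltW.
move: (Num.sqrt nu) r0 => r r0 ->.
rewrite lnXn// ler_pdivrMr ?exprn_gt0//.
have -> : 2 / r * r ^+ 2 = 2 * r by field; rewrite gt_eqF.
have := ln_sublinear r0; rewrite mulr2n; lra.
Qed.

End positive_part.

Lemma measurable_nat_fun (R : realType) (T : Omega -> nat) (g : nat -> R) :
  (forall k, measurable ([set w | (k < T w)%N] : set Omega)) ->
  measurable_fun [set: Omega] (fun w => g (T w)).
Proof.
move=> mT _ B mB; rewrite setTI.
rewrite [X in measurable X](_ : _ = \bigcup_(n in [set n | B (g n)]) [set w | T w = n]).
  apply: bigcup_measurable => n _.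
  case: n => [|n].
    rewrite [X in measurable X](_ : _ = ~` [set w | (0 < T w)%N]).
      exact: measurableC.
    apply/seteqP; split => w /=; first by move=> ->.
    by move/negP; rewrite -leqNgt leqn0 => /eqP.
  rewrite [X in measurable X](_ : _ = [set w | (n < T w)%N] `&` ~` [set w | (n.+1 < T w)%N]).
    by apply: measurableI => //; exact: measurableC.
  apply/seteqP; split => w /=; first by move=> ->; rewrite ltnn.
  by move=> [nT /negP]; rewrite -leqNgt => Tn; apply/eqP; rewrite eqn_leq Tn nT.
by apply/seteqP; split => w /=; [exists (T w)|case=> n /= Bn ->].
Qed.

(** * Influences and the tail of the witness maximum *)

Section tail.
Variables (P : probability Omega RR) (f : Omega -> bool).
Hypotheses (uP : uniform_product P) (mf : boolean_function f).
Hypothesis ff : finitary P f.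

Lemma pr_never_determined : pr P (~` \bigcup_n determined P f n) = 0.
Proof.
have mU : measurable (\bigcup_n determined P f n).
  by apply: bigcup_measurable => n _; exact: measurable_determined.
case: ff => N [mN N0 NS].
have prN : pr P N = 0 by rewrite /pr N0.
apply/eqP; rewrite eq_le pr_ge0 andbT -prN; apply: le_pr => //.
  exact: measurableC.
move=> w nw; apply: NS => /= -[s ws]; apply: nw.
by exists (maxW s) => //; exact: witness_determined.
Qed.

(** Continuity of [P] along the increasing events [determined P f n], whose union has probability 1
    by finitariness. *)
Lemma pr_undetermined_lt (e : RR) : 0 < e ->
  exists n, pr P (~` determined P f n) < e.
Proof.
move=> e0; have mdet := measurable_determined P mf.
have mU : measurable (\bigcup_n determined P f n).
  by apply: bigcup_measurable.
have P1 : P (\bigcup_n determined P f n) = 1%E.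
  have := prID P measurableT mU; rewrite !setTI pr_never_determined addr0 prT.
  by rewrite prE// => <-.
have cv : P (determined P f n) @[n --> \oo] --> 1%E.
  rewrite -P1; apply: nondecreasing_cvg_mu => //.
  by move=> n m nm; apply/subsetPset; exact: determinedS.
have /cv [n _ Hn] : nbhs (1%:E : \bar RR) [set x : \bar RR | ((1 - e)%:E < x)%E].
  apply: open_nbhs_nbhs; split; first exact: open_ereal_gt_ereal.
  by rewrite /= lte_fin; lra.
exists n; have /= := Hn n (leqnn n).
rewrite prE// lte_fin.
have := prID P measurableT (mdet n); rewrite !setTI prT; lra.
Qed.

Lemma measurable_ltn_maxWf k : measurable ([set w | (k < maxW (Wf P f w))%N] : set Omega).
Proof.
rewrite [X in measurable X](_ : _ = ~` determined P f k `&` \bigcup_n determined P f n).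
  apply: measurableI; first by apply: measurableC; exact: measurable_determined.
  by apply: bigcup_measurable => n _; exact: measurable_determined.
apply/seteqP; split => w /=; first by move=> /(ltn_maxWf P mf)[ndk [n dn]]; split => //; exists n.
by move=> [ndk [n _ dn]]; apply/(ltn_maxWf P mf); split => //; exists n.
Qed.

Lemma influence_le_ltn_maxWf k :
  influence P f k <= pr P [set w | (k < maxW (Wf P f w))%N].
Proof.
(* If the first [k] bits of [w] determine [f] and flipping bit [k] changes [f],
   then [flip k w] lies in the null event [B (f w)]. *)
pose B b := [set w | pr P (cylinder (prefix_of k w) `&` [set w | f w != b]) = 0]
  `&` [set w | f w != b].
have mB b : measurable (B b).
  apply: measurableI; last exact: (measurable_preim (predC1 b) mf).
  exact: (measurable_prefix k
    [set s | pr P (cylinder s `&` [set w | f w != b]) = 0]).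
(* On each cylinder of length [k], either the event [f w != b] is null or [B b] is empty. *)
have B0 b : pr P (B b) = 0.
  rewrite -(avg_pr P k (mB b)) -[RHS](avg_cst k); apply: eq_avg => s sk.
  suff -> : pr P (cylinder s `&` B b) = 0 by rewrite mulr0.
  have mC := measurable_cylinder_neq mf s b.
  have mCB : measurable (cylinder s `&` B b).
    by apply: measurableI => //; exact: measurable_cylinder.
  have [H|H] := pselect (pr P (cylinder s `&` [set w | f w != b]) = 0).
    apply/eqP; rewrite eq_le pr_ge0 andbT -H.
    by apply: le_pr => // w [? []].
  rewrite (_ : cylinder s `&` B b = set0) ?/pr ?measure0//.
  apply/seteqP; split => // w [+ [/= Hw _]].
  by rewrite /cylinder /= sk => sw; apply: H; rewrite -sw.
(* The maximum defaults to 0 on [N], so this null set is bounded separately. *)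
pose N := ~` \bigcup_n determined P f n.
have mN : measurable N.
  apply: measurableC; apply: bigcup_measurable => n _; exact: measurable_determined.
have mfl A : measurable A -> measurable (flip k @^-1` A : set Omega).
  by move=> mA; have := measurable_flip k measurableT mA; rewrite setTI.
have m1 := mfl _ (mB true); have m2 := mfl _ (mB false).
have mM := measurable_ltn_maxWf k.
rewrite /influence -[fine _]/(pr P _).
apply: (@le_trans _ _ (pr P ([set w | (k < maxW (Wf P f w))%N] `|`
   (N `|` (flip k @^-1` B true `|` flip k @^-1` B false))))).
  apply: le_pr; first exact: measurable_sensitive.
    by do ?apply: measurableU.
  move=> w /= sw; have [dw|nd] := pselect (exists n, determined P f n w); last first.
    by right; left => -[n _ dn]; apply: nd; exists n.
  have [dk|ndk] := pselect (determined P f k w); last first.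
    by left; apply/ltn_maxWf.
  right; right; move: dk sw; rewrite /determined /B /= prefix_flip_ge//.
  by case: (f w) => dk sw; [left|right].
apply: le_trans (prU_le P mM _) _; first by do ?apply: measurableU.
rewrite gerDl; apply: le_trans (prU_le P mN _) _; first exact: measurableU.
rewrite pr_never_determined add0r; apply: le_trans (prU_le P m1 m2) _.
by rewrite !pr_flip// !B0 addr0.
Qed.

(** The sum is the expectation of weighted indicators, bounded pointwise by the excess of the
    witness maximum over [nu] and then by its [p]-th power. *)
Lemma sum_excess_step_pr n (nu p : RR) : 0 < nu -> 1 < p ->
  (\int[P]_w ((maxWf P f w `^ p)%:E) < +oo)%E ->
  \sum_(k < n) excess_step nu k * pr P [set w | (k < maxW (Wf P f w))%N]
  <= nu * ((p - 1)^-1 * (fine (\int[P]_w ((maxWf P f w `^ p)%:E)) / nu `^ p)).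
Proof.
move=> nu0 p1 fin; have mM := measurable_ltn_maxWf.
have c0 : 0 <= nu * (p - 1)^-1 / nu `^ p.
  by rewrite !mulr_ge0 ?invr_ge0 ?powR_ge0 ?subr_ge0// ltW.
have finI : (\int[P]_w ((maxWf P f w `^ p)%:E))%E \is a fin_num.
  by rewrite ge0_fin_numE// integral_ge0// => w _; rewrite lee_fin powR_ge0.
rewrite [leRHS](_ : _ = nu * (p - 1)^-1 / nu `^ p *
   fine (\int[P]_w ((maxWf P f w `^ p)%:E))); last by ring.
rewrite -lee_fin EFinM fineK// -ge0_integralZl_EFin//; last first.
- by apply/measurable_EFinP; exact: (measurable_nat_fun (fun m => m%:R `^ p)).
- by move=> w _; rewrite lee_fin powR_ge0.
rewrite -sumEFin.
under eq_bigr => k _.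
  rewrite EFinM -prE// -[X in P X]setIT -integral_indic//.
  rewrite -ge0_integralZl_EFin//; last first.
  - by case/andP: (excess_step01 nu k).
  - exact/measurable_EFinP/measurable_indic.
  over.
rewrite -ge0_integral_sum//; last first.
- move=> k w _; rewrite -EFinM lee_fin mulr_ge0//.
  by case/andP: (excess_step01 nu k).
- by move=> k; apply/measurable_EFinP; apply: measurable_funM.
apply: ge0_le_integral => //.
- move=> w _; apply: sume_ge0 => k _; rewrite -EFinM lee_fin mulr_ge0//.
  by case/andP: (excess_step01 nu k).
- by apply: emeasurable_sum => k; apply/measurable_EFinP; apply: measurable_funM.
- apply/measurable_EFinP; apply: measurable_funM => //.
  exact: (measurable_nat_fun (fun m => m%:R `^ p)).
move=> w _; rewrite -EFinM.
under eq_bigr do rewrite -EFinM.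
rewrite sumEFin lee_fin; apply: le_trans (excess_le_powR _ nu0 p1).
apply: le_trans (sum_excess_step n _ (ltW nu0)).
apply: ler_sum => k _; rewrite indicE.
suff -> : (w \in [set w | (k < maxW (Wf P f w))%N]) = (k < maxW (Wf P f w))%N by [].
by apply/idP/idP; rewrite inE.
Qed.

(** Each influence is bounded by a convex combination of the supremum and the tail probability, with
    weight [excess_step nu k] on the tail. The weights on the supremum add up to at most [nu]. *)
Lemma sum_influence_le n (nu p : RR) : 0 < nu -> 1 < p ->
  (\int[P]_w ((maxWf P f w `^ p)%:E) < +oo)%E ->
  \sum_(k < n) influence P f k <= nu * (sup (range (influence P f)) +
    (p - 1)^-1 * (fine (\int[P]_w ((maxWf P f w `^ p)%:E)) / nu `^ p)).
Proof.
move=> nu0 p1 fin; rewrite mulrDr.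
have d0 : 0 <= sup (range (influence P f)).
  exact: le_trans (influence_ge0 P f 0) (influence_le_sup P mf 0).
have := ler_wpM2r d0 (sum_onem_excess_step n (ltW nu0)).
move=> /lerD/(_ (sum_excess_step_pr n nu0 p1 fin)); apply: le_trans.
rewrite mulr_suml -big_split /=; apply: ler_sum => k _.
have /andP[a0 a1] := excess_step01 nu k.
have h1 := influence_le_sup P mf k; have h2 := influence_le_ltn_maxWf k.
have := ler_wpM2l a0 h2.
have : (1 - excess_step nu k) * influence P f k <=
  (1 - excess_step nu k) * sup (range (influence P f)).
  by apply: ler_wpM2l => //; rewrite subr_ge0.
lra.
Qed.

End tail.

(** * Comparison of the two bounds *)

(** [kkl_energy] with [t] the square root of [nu]: the second hypothesis on [nu] gives
    [t * delta <= 1], so its right side is at most [2 * S]. The other factors of 16 are 4 from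
    [VarE] and 2 from [ln nu = 2 * ln t]. *)
Lemma kkl_finitary (P : probability Omega RR) (f : Omega -> bool) (S nu : RR) :
  uniform_product P -> boolean_function f -> finitary P f -> 1 < nu ->
  sup (range (influence P f)) * Num.sqrt nu <= 1 ->
  (forall n, \sum_(k < n) influence P f k <= S) ->
  Var P f * ln nu <= 16 * S.
Proof.
move=> uP mf ff nu1 dnu HS.
have nu0 : 0 < nu by lra.
have r0 : 0 < Num.sqrt nu by rewrite sqrtr_gt0.
have l0 : 0 < ln nu by exact: ln_gt0.
have lr : ln nu = 2 * ln (Num.sqrt nu).
  by rewrite -{1}(sqr_sqrtr (ltW nu0)) lnXn// mulr2n; ring.
rewrite VarE//; set q := pr P _.
apply/ler_addgt0Pr => e e0.
(* The truncation error is later multiplied by [4 * ln nu], hence this tolerance. *)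
have [n Hn] := pr_undetermined_lt mf ff (divr_gt0 e0 (mulr_gt0 (ltr0n RR 4) l0)).
have kkl := kkl_energy (n := n) (h := cond_prob P f n)
  (delta := sup (range (influence P f))) r0
  (fun k kn => le_trans (abs_infl_cond_prob uP mf kn) (influence_le_sup P mf k)).
have vn := variance_cond_prob uP mf n; rewrite -/q in vn.
have en := energy_le_abs_infl uP mf n.
have sn : \sum_(k < n) abs_infl n k (cond_prob P f n) <= S.
  by apply: le_trans (HS n); apply: ler_sum => k _; exact: abs_infl_cond_prob.
have s0 : 0 <= \sum_(k < n) abs_infl n k (cond_prob P f n).
  by apply: sumr_ge0 => k _; apply: avg_ge0.
move: vn en sn s0 kkl Hn dnu; rewrite [sup _ * _]mulrC lr.
set V := cube_var _ _; set E := energy _ _; set A := \sum_(k < n) _.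
set u := pr P _; set d := Num.sqrt nu * _; set l := ln _.
move=> vn en sn s0 kkl Hn dnu.
have l20 : 0 < l by move: l0; rewrite lr -/l; lra.
have dA : d * A <= A by rewrite ler_piMl.
have e1 : u * (4 * (2 * l)) <= e.
  by rewrite -ler_pdivlMr ?mulr_gt0//; apply: ltW.
have h1 : (q * (1 - q) - u) * l <= V * l by rewrite ler_pM2r.
have u0 : 0 <= u := pr_ge0 P _.
(* Needed to discard the 1 in [V * (1 + l)]; it is Cauchy-Schwarz against a constant. *)
have V0 : 0 <= V.
  have := avg_cauchy_schwarz n (cond_prob P f n) (fun=> 1).
  rewrite avg_cst expr1n mulr1 /V /cube_var subr_ge0.
  by under eq_avg do rewrite mulr1.
lra.
Qed.

(** [4 * q * (1 - q) = 1 - (1 - 2 * q) ^ 2]. *)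
Lemma Var_le1 (P : probability Omega RR) (f : Omega -> bool) :
  boolean_function f -> 0 <= Var P f <= 1.
Proof.
move=> mf; rewrite VarE//.
have mF : measurable ([set w | f w] : set Omega) := measurable_preim id mf.
have q0 := pr_ge0 P [set w | f w]; have q1 := pr_le1 P mF.
have := sqr_ge0 (1 - 2 * pr P [set w | f w]).
move: q0 q1; set q := pr P _ => q0 q1 sq.
have : 0 <= q * (1 - q) by rewrite mulr_ge0// subr_ge0.
by move: sq; rewrite expr2 => *; apply/andP; split; lra.
Qed.

Theorem mainTheorem17 :
  exists c : RR, 0 < c /\
  forall (P : probability Omega RR), uniform_product P ->
  forall (p : RR), 1 < p ->
  forall f : Omega -> bool, boolean_function f -> knowable P p f -> nonconstant P f ->
  let nu := fine (\int[P]_w (maxWf P f w)%:E) in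
  let Ep := fine (\int[P]_w ((maxWf P f w `^ p)%:E)) in
  sup (range (influence P f)) >=
    c * Var P f * (ln nu / nu) - (p - 1)^-1 * (Ep / nu `^ p).
Proof.
(* The inverse of the constant in [kkl_finitary]. *)
exists (1 / 16); split; first lra.
move=> P uP p p1 f mf [ff fin] _; lazy zeta.
set nu := fine (\int[P]_w (maxWf P f w)%:E); set Ep := fine _.
have d0 : 0 <= sup (range (influence P f)).
  exact: le_trans (influence_ge0 P f 0) (influence_le_sup P mf 0).
have /andP[V0 V1] := Var_le1 P mf.
have E0 : 0 <= (p - 1)^-1 * (Ep / nu `^ p).
  rewrite !mulr_ge0 ?invr_ge0 ?powR_ge0 ?subr_ge0 ?(ltW p1)//.
  by rewrite fine_ge0// integral_ge0// => w _; rewrite lee_fin powR_ge0.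
(* For [nu <= 1] the logarithm is at most 0 and so is the claimed lower bound; this includes
   [nu = 0], where the quotient is 0 by convention. *)
have [nu1|nu1] := leP nu 1.
  have nu0 : 0 <= nu.
    by rewrite fine_ge0// integral_ge0// => w _; rewrite lee_fin ler0n.
  have : 0 <= (1 / 16) * Var P f * (- ln nu / nu).
    by rewrite !mulr_ge0 ?invr_ge0 ?oppr_ge0 ?ln_le0//; lra.
  rewrite mulNr mulrN; lra.
have nu0 : 0 < nu by lra.
have r0 : 0 < Num.sqrt nu by rewrite sqrtr_gt0.
(* If the supremum exceeds the inverse square root of [nu], then [ln_div_le] and [Var P f <= 1]
   suffice, as 2/16 < 1. *)
have [dnu|dnu] := leP (sup (range (influence P f)) * Num.sqrt nu) 1; last first.
  have : (Num.sqrt nu)^-1 <= sup (range (influence P f)).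
    by rewrite -[leLHS]mul1r ler_pdivrMr// ltW.
  have : Var P f * (ln nu / nu) <= 1 * (2 / Num.sqrt nu).
    by apply: ler_pM => //; [rewrite divr_ge0 ?ln_ge0 ?ltW|exact: ln_div_le].
  have : 0 < (Num.sqrt nu)^-1 by rewrite invr_gt0.
  rewrite -mulrA; lra.
have := kkl_finitary uP mf ff nu1 dnu
  (fun n => sum_influence_le uP mf ff n nu0 p1 fin).
rewrite -/Ep [nu * _]mulrC mulrA -ler_pdivrMr// -mulrA.
lra.
Qed.
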